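(* Let $\mathcal{S}=(X,\phi,q)$ be a max-plus IFS such that $q_j(x)=q_j$ does not depend on $x$. Then there exists a unique invariant idempotent probability for $M_{\phi,q}$. Let $\lambda\in U(X,\mathbb{R}_{\max})$ be its density. Then for any $z\in\Omega$ and every $x\in X$ we have $$\lambda(x)=S(x,z)=\bigoplus_{(j_1,j_2,j_3,\dots)\in\pi^{-1}(x)}[q_{j_1}+q_{j_2}+q_{j_3}+\cdots].$$
   Context: Notation: $\mathbb{R}_{\max}=\mathbb{R}\cup\{-\infty\}$, $a\oplus b=\max(a,b)$, $a\odot b=a+b$ with $a\odot(-\infty)=-\infty$; $\bigoplus_{i\in A}$ denotes the supremum over $i\in A$, equal to $-\infty$ if $A=\varnothing$. For a compact metric space $X$, $C(X,\mathbb{R})$ is the set of continuous real functions, and $C^*(X,\mathbb{R})$ is the set of all $m:C(X,\mathbb{R})\to\mathbb{R}$ with $m(a\odot f)=a\odot m(f)$ and $m(f\oplus g)=m(f)\oplus m(g)$ for all $a\in\mathbb{R}$, $f,g\in C(X,\mathbb{R})$ (operations on functions are pointwise). $I(X)$ is the set of $m\in C^*(X,\mathbb{R})$ with $m(0)=0$ (idempotent probabilities). $U(X,\mathbb{R}_{\max})$ is the set of upper semi-continuous functions $\lambda:X\to\mathbb{R}_{\max}$ that are not identically $-\infty$. Every $\mu\in C^*(X,\mathbb{R})$ has a unique $\lambda\in U(X,\mathbb{R}_{\max})$, called its density, with $\mu(f)=\bigoplus_{x\in X}\lambda(x)\odot f(x)$ for all $f\in C(X,\mathbb{R})$. A max-plus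 IFS (mpIFS) $\mathcal{S}=(X,\phi,q)$ consists of compact metric spaces $(X,d_X)$, $(J,d_J)$, maps $\phi_j:X\to X$ ($j\in J$) and functions $q_j:X\to\mathbb{R}$ ($j\in J$) such that: there is $0<\gamma<1$ with $d_X(\phi_{j_1}(x_1),\phi_{j_2}(x_2))\le\gamma[d_J(j_1,j_2)+d_X(x_1,x_2)]$ for all $j_1,j_2\in J$, $x_1,x_2\in X$; there is $C>0$ with $|q_j(x_1)-q_j(x_2)|\le C\,d_X(x_1,x_2)$ for all $j\in J$, $x_1,x_2\in X$; $\bigoplus_{j\in J}q_j(x)=0$ for all $x\in X$; and $q(j,x)=q_j(x)$ is continuous on $J\times X$. Write $\phi(j,x)=\phi_j(x)$. The operator $M_{\phi,q}:I(X)\to I(X)$ is $M_{\phi,q}(\mu)(f)=\bigoplus_{j\in J}\mu(q_j\odot(f\circ\phi_j))$, $f\in C(X,\mathbb{R})$; $\mu$ is invariant if $M_{\phi,q}(\mu)=\mu$. For $n\in\mathbb{N}=\{1,2,\dots\}$, $\omega=(j_1,\dots,j_n)\in J^n$ and $x\in X$, put $\phi_\omega(x)=\phi_{j_1}\circ\cdots\circ\phi_{j_n}(x)$ and $\mathrm{Sum}(\omega,x)=q_{j_1}(\phi_{(j_2,\dots,j_n)}(x))+q_{j_2}(\phi_{(j_3,\dots,j_n)}(x))+\cdots+q_{j_n}(x)$ (which equals $q_{j_1}+\cdots+q_{j_n}$ when the weights do not depend on $x$). For $\varepsilon>0$, $S_\varepsilon(x,y)=\bigoplus_{n\in\mathbb{N}}\bigoplus_{\omega\in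 J^n,\ d_X(x,\phi_\omega(y))<\varepsilon}\mathrm{Sum}(\omega,y)$. The Mañé potential is $S(x,y)=\lim_{\varepsilon\to0}S_\varepsilon(x,y)\in[-\infty,0]$, and the Aubry set is $\Omega=\{x\in X: S(x,x)=0\}$. The map $\pi:J^{\mathbb{N}}\to X$ sends $\omega=(j_1,j_2,\dots)$ to the unique point $\pi(\omega)\in X$ satisfying $\pi(\omega)=\lim_{n\to\infty}\phi_{j_1}\circ\cdots\circ\phi_{j_n}(x_n)$ for every sequence $(x_n)$ in $X$. All $q_j\le0$, so the infinite sums are well defined in $[-\infty,0]$. *)

(* Defs.v *)
From HB Require Import structures.
From mathcomp Require Import all_boot all_order all_algebra.
From mathcomp Require Import all_classical all_reals all_analysis.
From mathcomp Require Import lra.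

Set Implicit Arguments.
Unset Strict Implicit.
Unset Printing Implicit Defensive.

Import Order.TTheory GRing.Theory Num.Theory.
Import numFieldNormedType.Exports.

Local Open Scope classical_set_scope.
Local Open Scope ring_scope.

Section continuous_functions.
Context {R : realType} {X : metricType R}.
Implicit Types (a : R) (f g : continuousType X R).

Lemma max_scale_continuous a f : continuous (fun x => a + f x).
Proof. by move=> x; apply: cvgD; [exact: cvg_cst|exact: cts_fun]. Qed.

Lemma max_add_continuous f g : continuous (f \max g).
Proof.
by move=> x; apply: (@continuous_max R X); exact: cts_fun.
Qed.

Definition max_scale a f : continuousType X R :=
  mkcts (@max_scale_continuous a f).

Definition max_add f g : continuousType X R :=
  mkcts (@max_add_continuous f g).

Lemma max_scaleE a f x : max_scale a f x = a + f x.
Proof. by []. Qed.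

Lemma max_addE f g x : max_add f g x = Num.max (f x) (g x).
Proof. by []. Qed.

End continuous_functions.

Section functionals.
Context {R : realType} {X : metricType R}.
Implicit Types (m mu : continuousType X R -> R) (lam : X -> \bar R).

Definition maxplus_linear m :=
  (forall (a : R) (f : continuousType X R), m (max_scale a f) = a + m f) /\
  (forall f g : continuousType X R,
     m (max_add f g) = Num.max (m f) (m g)).

Definition idempotent_prob m := maxplus_linear m /\ m (cst 0) = 0.

Definition upper_semicontinuous lam := forall x a, (lam x < a%:E)%E ->
  exists2 V, nbhs x V & forall y, V y -> (lam y < a%:E)%E.

(* R_max is represented by the extended reals different from +oo. *)
Definition usc_Rmax lam :=
  [/\ forall x, lam x != +oo%E,
      upper_semicontinuous lam
    & exists x, lam x != -oo%E].

Definition is_density m lam := usc_Rmax lam /\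
  forall f, (m f)%:E = ereal_sup (range (fun x => (lam x + (f x)%:E)%E)).

(* On a compact space, the unique density of a max-plus linear functional;
   see [densityP] and [is_density_unique]. *)
Definition density m : X -> \bar R := xget (cst -oo%E) (is_density m).

Lemma maxplus_linear_le m (f g : continuousType X R) : maxplus_linear m ->
  (forall x, f x <= g x) -> m f <= m g.
Proof.
move=> [_ mD] fg; have <- : max_add f g = g.
  by apply/continuousEP => x; rewrite max_addE max_r.
by rewrite mD le_max lexx.
Qed.

Lemma lipschitz_continuous (K : R) (h : X -> R) :
  (forall x y, `|h x - h y| <= K * mdist x y) -> continuous h.
Proof.
move=> hK x; apply/cvgrPdist_lt => e e0.
have K1 : 0 < `|K| + 1 by rewrite ltr_wpDl.
have d0 : 0 < e / (`|K| + 1) by rewrite divr_gt0.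
near=> y.
have : ball x (e / (`|K| + 1)) y by near: y; exact: nbhsx_ballx.
rewrite ballEmdist/= ltr_pdivlMr// => xy.
rewrite (le_lt_trans (hK _ _))// (le_lt_trans _ xy)//.
rewrite mulrC ler_wpM2l ?mdist_ge0//.
by rewrite (le_trans (ler_norm _))// lerDl.
Unshelve. all: by end_near. Qed.

Lemma mdist_continuous (x0 : X) : continuous (fun x => mdist x0 x : R).
Proof.
apply: (@lipschitz_continuous 1) => x y; rewrite mul1r ler_norml.
have := metric_triangle x0 x y; have := metric_triangle x0 y x.
by rewrite (metric_sym y x) => h1 h2; apply/andP; split; lra.
Qed.

Lemma is_density_exists m : compact [set: X] -> maxplus_linear m ->
  exists lam, is_density m lam.
Proof.
move=> cX mlin; have [mZ mD] := mlin.
pose lam x := ereal_inf (range (fun g : continuousType X R => (m g - g x)%:E)).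
have lam_le x g : (lam x <= (m g - g x)%:E)%E.
  by apply: ereal_inf_lbound; exists g.
have lam_fin x : lam x != +oo%E.
  by rewrite lt_eqF// (le_lt_trans (lam_le x (cst 0)))// ltry.
have lam_sup f :
    (m f)%:E = ereal_sup (range (fun x => (lam x + (f x)%:E)%E)).
  apply/eqP; rewrite eq_le; apply/andP; split; last first.
    apply/ereal_supP => _ [x _ <-].
    by rewrite (le_trans (leeD2r _ (lam_le x f)))// -EFinD subrK.
  rewrite leNgt; apply/negP.
  set s := ereal_sup _ => sm.
  have [c sc cm] : exists2 c : R, (s <= c%:E)%E & c < m f.
    case: s sm => [r| |]//.
    - by rewrite lte_fin => rm; exists r.
    - by exists (m f - 1); rewrite ?leNye// ltrBlDr ltrDl.
  have [c' cc' c'm] : exists2 c', c < c' & c' < m f.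
    by exists ((c + m f) / 2); rewrite midf_lt.
  pose P (A : set X) := exists2 h : continuousType X R,
    m h <= c' & forall y, A y -> f y <= h y.
  have PU A B : P A -> P B -> P (A `|` B).
    move=> [h hc hA] [k kc kB]; exists (max_add h k).
      by rewrite mD ge_max hc kc.
    by move=> y; rewrite max_addE le_max => -[/hA ->|/kB ->]//;
      rewrite orbT.
  have PS A B : A `<=` B -> P B -> P A.
    by move=> AB [h hc hB]; exists h => // y /AB/hB.
  have P0 : P set0.
    exists (max_scale (c' - m f) f) => //.
    by rewrite mZ subrK.
  have Ploc (x : X) : exists2 V, nbhs x V & P V.
    have : (lam x < (c' - f x)%:E)%E.
      have : (lam x + (f x)%:E <= c%:E)%E.
        by rewrite (le_trans _ sc)//; apply: ereal_sup_ubound; exists x.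
      move: (lam_fin x); case: (lam x) => [r| |]//; last by rewrite ltNyr.
      by rewrite -EFinD !lee_fin lte_fin => _ rc; lra.
    move=> /ereal_inf_lt[_ [g _ <-]]; rewrite lte_fin => gx.
    exists [set y | f y - g y < c' - m g].
      have cfg : {for x, continuous (fun y => f y - g y)}.
        by apply: cvgB; exact: cts_fun.
      by apply: (cvgr_lt _ cfg); lra.
    exists (max_scale (c' - m g) g); first by rewrite mZ subrK.
    by move=> y /= yV; rewrite max_scaleE; lra.
  have nPT : ~ P setT.
    move=> [h hc hf].
    have := maxplus_linear_le mlin (fun x => hf x I).
    by move=> mfh; have := lt_le_trans c'm mfh; rewrite ltNge hc.
  pose F := [set A : set X | P (~` A)].
  have FF : ProperFilter F.
    apply: Build_ProperFilter_ex.
      move=> A FA; apply: contrapT => /forallNP A0; apply: nPT.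
      by apply: PS FA => x _ /= Ax; exact: (A0 x).
    split => [|A B FA FB|A B AB]; rewrite /F/=.
    - by rewrite setCT.
    - by rewrite setCI; exact: PU.
    - by apply: PS; exact: subsetC.
  have [|x [_ Fx]] := cX F FF; first by rewrite /F/= setCT.
  have [V xV PV] := Ploc x.
  have [||y [nVy Vy]] := Fx (~` V) V; rewrite /F/= ?setCK//.
exists lam; split => //; split => //.
  move=> x a /ereal_inf_lt[_ [g _ <-]]; rewrite lte_fin => gx.
  exists [set y | m g - g y < a].
    have cg : {for x, continuous (fun y => m g - g y)}.
      by apply: cvgB; [exact: cvg_cst|exact: cts_fun].
    exact: (cvgr_lt _ cg).
  by move=> y /= ya; rewrite (le_lt_trans (lam_le y g))// lte_fin.
apply: contrapT => /forallNP lamN.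
have := lam_sup (cst 0).
suff : (ereal_sup (range (fun x => lam x + (@cst X R 0 x)%:E)) <= -oo)%E.
  by move=> s_le s_eq; move: s_le; rewrite -s_eq.
apply/ereal_supP => _ [x _ <-].
by have /negP := lamN x; rewrite negbK => /eqP ->.
Qed.

Lemma is_density_unique m lam lam' :
  is_density m lam -> is_density m lam' -> lam = lam'.
Proof.
suff H lam1 lam2 x : is_density m lam1 -> is_density m lam2 ->
    (lam1 x <= lam2 x)%E.
  by move=> d d'; apply/funext => x; apply/eqP; rewrite eq_le !H.
move=> [_ E1] [[fin2 usc2 _] E2]; rewrite leNgt; apply/negP => lam21.
have [a lam2a alam1] : exists2 a : R, (lam2 x < a%:E)%E & (a%:E < lam1 x)%E.
  move: lam21 (fin2 x); case: (lam2 x) => [r| |]//; case: (lam1 x) => [s| |]//.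
  - by rewrite lte_fin => rs _; exists ((r + s) / 2); rewrite lte_fin midf_lt.
  - by move=> _ _; exists (r + 1); rewrite ?ltry// lte_fin ltrDl.
  - by move=> _ _; exists (s - 1); rewrite ?ltNyr// lte_fin ltrBlDr ltrDl.
  - by move=> _ _; exists 0; rewrite ?ltNyr ?ltry.
have [V xV Va] := usc2 _ _ lam2a.
move/nbhs_ballP : xV => [r /= r0 rV].
pose K := `|m (cst 0) - a| / r.
have fc : continuous (fun y => - (K * mdist x y) : R).
  move=> y; apply: cvgN; apply: cvgM; first exact: cvg_cst.
  exact: mdist_continuous.
pose f : continuousType X R := mkcts fc.
have fE y : f y = - (K * mdist x y) by [].
have fa : ((m f)%:E <= a%:E)%E.
  rewrite E2; apply/ereal_supP => _ [y _ <-].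
  have [yr|ry] := ltP (mdist x y) r.
    have lam2y : (lam2 y <= a%:E)%E by apply/ltW/Va/rV; rewrite ballEmdist.
    rewrite (le_trans (leeD2r _ lam2y))// -EFinD lee_fin fE gerDl oppr_le0.
    by rewrite mulr_ge0 ?mdist_ge0// divr_ge0// ltW.
  have lam2y : (lam2 y <= (m (cst 0))%:E)%E.
    rewrite E2; apply: ereal_sup_ubound; exists y => //.
    by rewrite adde0.
  rewrite (le_trans (leeD2r _ lam2y))// -EFinD lee_fin fE.
  have : `|m (cst 0) - a| <= K * mdist x y.
    by rewrite /K mulrAC ler_pdivlMr// ler_wpM2l.
  by move=> aK; rewrite lerBlDr -lerBlDl (le_trans (ler_norm _) aK).
have : (lam1 x <= a%:E)%E.
  rewrite (le_trans _ fa)// E1; apply: ereal_sup_ubound; exists x => //.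
  by rewrite fE mdistxx mulr0 oppr0 adde0.
by rewrite leNgt alam1.
Qed.

Lemma densityP m : compact [set: X] -> maxplus_linear m ->
  is_density m (density m).
Proof.
by move=> cX mlin; apply: xgetPex; exact: is_density_exists.
Qed.

End functionals.

(* The space is required to be nonempty; the index space is then nonempty by
   the normalization of the weights, see [index_nonempty]. *)
Record mpIFS (R : realType) (X J : metricType R) := MpIFS {
  mp_map : J -> X -> X;
  mp_weight : J -> X -> R;
  mpIFS_nonempty : [set: X] !=set0;
  mpIFS_compact : compact [set: X];
  mpIFS_compact_index : compact [set: J];
  mpIFS_contract : exists2 gamma : R, 0 < gamma < 1 &
    forall j1 j2 x1 x2, mdist (mp_map j1 x1) (mp_map j2 x2) <=
      gamma * (mdist j1 j2 + mdist x1 x2);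
  mpIFS_lipschitz : exists2 C : R, 0 < C &
    forall j x1 x2, `|mp_weight j x1 - mp_weight j x2| <= C * mdist x1 x2;
  mpIFS_normalized : forall x,
    ereal_sup (range (fun j => (mp_weight j x)%:E)) = 0%E;
  mpIFS_continuous : continuous (fun p : J * X => mp_weight p.1 p.2)
}.

Section mpIFS_theory.
Context {R : realType} {X J : metricType R} (S : mpIFS X J).
Implicit Types (x y : X) (j : J) (f : continuousType X R).
Implicit Types mu : continuousType X R -> R.

Lemma mp_map_continuous j : continuous (mp_map S j).
Proof.
have [g /andP[g0 g1] gP] := mpIFS_contract S.
move=> x; apply/metricType_numDomainType.cvgrPdist_lt => e e0; near=> y.
have : ball x e y by near: y; exact: nbhsx_ballx.
rewrite ballEmdist/=; apply: le_lt_trans.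
by rewrite (le_trans (gP _ _ _ _))// mdistxx add0r ler_piMl ?mdist_ge0// ltW.
Unshelve. all: by end_near. Qed.

Lemma transfer_continuous j f :
  continuous (fun x => mp_weight S j x + f (mp_map S j x)).
Proof.
have [C _ CP] := mpIFS_lipschitz S.
move=> x; apply: cvgD; first exact: (lipschitz_continuous (CP j)).
by apply: continuous_comp; [exact: mp_map_continuous|exact: cts_fun].
Qed.

Definition transfer j f : continuousType X R :=
  mkcts (@transfer_continuous j f).

Lemma transferE j f x : transfer j f x = mp_weight S j x + f (mp_map S j x).
Proof. by []. Qed.

(* For an idempotent probability [mu] the supremum is that of a nonempty bounded
   set, and the result is an idempotent probability; see [has_sup_mpop] and
   [mpop_idempotent_prob]. *)
Definition mpop mu : continuousType X R -> R :=
  fun f => sup (range (fun j => mu (transfer j f))).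

Definition mp_invariant mu := mpop mu = mu.

(* In [word_map [:: j1; ...; jn]] the map of jn acts first. The words in J^n,
   n >= 1, are the sequences of positive size. *)
Definition word_map (w : seq J) x : X := foldr (mp_map S) x w.

Fixpoint word_sum (w : seq J) x : R :=
  if w is j :: w' then mp_weight S j (word_map w' x) + word_sum w' x else 0.

Definition mane_eps (e : R) x y : \bar R :=
  ereal_sup [set (word_sum w y)%:E | w in
    [set w : seq J | (0 < size w)%N /\ mdist x (word_map w y) < e]].

Definition mane x y : \bar R := lim (mane_eps e x y @[e --> 0^'+]).

Definition aubry : set X := [set x | mane x x = 0%E].

Definition is_coding (w : nat -> J) (p : X) := forall xs : nat -> X,
  word_map (mkseq w n) (xs n) @[n --> \oo] --> p.

Lemma q_le0 j x : mp_weight S j x <= 0.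
Proof.
rewrite -lee_fin -[leRHS](mpIFS_normalized S x).
by apply: ereal_sup_ubound; exists j.
Qed.

Lemma index_nonempty : [set: J] !=set0.
Proof.
have [x _] := mpIFS_nonempty S; apply: contrapT => /forallNP J0.
have := mpIFS_normalized S x.
have -> : range (fun j => (mp_weight S j x)%:E) = set0.
  by apply/seteqP; split => [r [j _ _]|//]; exact: (J0 j I).
by rewrite ereal_sup0.
Qed.

Lemma diameter_bounded : exists2 D : R, 0 <= D &
  forall x y : X, mdist x y <= D.
Proof.
have [x0 x0T] := mpIFS_nonempty S.
have [|c _ cP] := @compact_EVT_max X R (mdist x0) setT
  (mpIFS_nonempty S) (mpIFS_compact S).
  apply: continuous_subspaceT; exact: mdist_continuous.
exists (mdist x0 c + mdist x0 c); first by rewrite addr_ge0// mdist_ge0.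
move=> x y; rewrite (le_trans (metric_triangle x x0 y))// metric_sym.
by rewrite lerD// cP// inE.
Qed.

Lemma word_map_contract : exists2 gamma : R, 0 < gamma < 1 &
  forall w x y, mdist (word_map w x) (word_map w y) <=
    gamma ^+ size w * mdist x y.
Proof.
have [g g01 gP] := mpIFS_contract S; exists g => //.
move=> w x y; elim: w => [|j w IH] /=; first by rewrite expr0 mul1r.
rewrite (le_trans (gP _ _ _ _))// mdistxx add0r exprS -mulrA.
by rewrite ler_wpM2l// ltW//; case/andP: g01.
Qed.

Lemma is_coding_exists w : exists p, is_coding w p.
Proof.
have [x0 _] := mpIFS_nonempty S.
have [D D0 DP] := diameter_bounded.
have [g /andP[g0 g1] gP] := word_map_contract.
pose a n := word_map (mkseq w n) x0.
have close n k y : mdist (word_map (mkseq w n) y) (a (n + k)%N) <= g ^+ n * D.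
  rewrite /a /mkseq iotaD map_cat add0n /word_map foldr_cat.
  rewrite (le_trans (gP _ _ _))// size_map size_iota.
  by rewrite ler_wpM2l// exprn_ge0// ltW.
have cX : compact [set: X] := mpIFS_compact S.
have [p [_ ap]] := cX (a @ \oo) _ filterT.
have closep n y : mdist (word_map (mkseq w n) y) p <= g ^+ n * D.
  apply/ler_addgt0Pl => e e0.
  have [||_ [[k /= nk <-] pk]] :=
      ap [set z | exists2 k, (n <= k)%N & a k = z] (ball p e).
  - by exists n => // k /= nk; exists k.
  - exact: nbhsx_ballx.
  move: pk; rewrite ballEmdist/= => pk.
  rewrite (le_trans (metric_triangle _ (a k) _))// addrC lerD//.
    by rewrite metric_sym ltW.
  by rewrite -(subnKC nk) close.
exists p => xs; apply/metricType_numDomainType.cvgrPdist_lt => e e0.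
have gD : g ^+ n * D @[n --> \oo] --> 0.
  rewrite -(mul0r D); apply: cvgMr_tmp; apply: cvg_expr.
  by rewrite gtr0_norm.
near=> n; rewrite metric_sym (le_lt_trans (closep _ _))//.
near: n; exact: (cvgr_lt _ gD).
Unshelve. all: by end_near. Qed.

Lemma is_coding_unique w p p' : is_coding w p -> is_coding w p' -> p = p'.
Proof.
have [x0 _] := mpIFS_nonempty S.
move=> /(_ (fun=> x0)) h /(_ (fun=> x0)) h'.
exact: (cvg_unique (@metric_hausdorff R X) h h').
Qed.

(* The coding map pi; the defining limit singles out one point, see
   [is_coding_unique]. *)
Definition coding (w : nat -> J) : X := sval (cid (is_coding_exists w)).

Lemma codingP w : is_coding w (coding w).
Proof. exact: svalP. Qed.

Lemma has_sup_mpop mu f : idempotent_prob mu ->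
  has_sup (range (fun j => mu (transfer j f))).
Proof.
move=> [mlin _]; split.
  by have [j _] := index_nonempty; exists (mu (transfer j f)), j.
have [|c _ cP] := @compact_EVT_max X R f setT
  (mpIFS_nonempty S) (mpIFS_compact S).
  by apply: continuous_subspaceT; exact: cts_fun.
exists (mu (cst (f c))) => _ [j _ <-].
apply: maxplus_linear_le => // x; rewrite transferE/=.
by rewrite -[leRHS]add0r lerD ?q_le0// cP// inE.
Qed.

Lemma mpop_idempotent_prob mu : idempotent_prob mu -> idempotent_prob (mpop mu).
Proof.
move=> mup; have [[muZ muD] mu0] := mup.
have ub f j : mu (transfer j f) <= mpop mu f.
  by apply: (ub_le_sup (has_sup_mpop f mup).2); exists j.
have lub f c : (forall j, mu (transfer j f) <= c) -> mpop mu f <= c.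
  move=> H; apply: ge_sup; first exact: (has_sup_mpop f mup).1.
  by move=> _ [j _ <-].
have tZ j a f : mu (transfer j (max_scale a f)) = a + mu (transfer j f).
  rewrite -muZ; congr mu; apply/continuousEP => x.
  by rewrite !transferE !max_scaleE addrCA.
have tD j f g : mu (transfer j (max_add f g)) =
    Num.max (mu (transfer j f)) (mu (transfer j g)).
  rewrite -muD; congr mu; apply/continuousEP => x.
  by rewrite !transferE !max_addE addr_maxr.
split; first split.
- move=> a f; apply/eqP; rewrite eq_le; apply/andP; split.
    by apply: lub => j; rewrite tZ lerD2l.
  rewrite -lerBrDl; apply: lub => j; rewrite lerBrDl -tZ; exact: ub.
- move=> f g; apply/eqP; rewrite eq_le; apply/andP; split.
    apply: lub => j; rewrite tD ge_max !le_max.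
    by rewrite (ub f) (ub g) orbT.
  rewrite ge_max; apply/andP; split; apply: lub => j;
    by rewrite (le_trans _ (ub _ j))// tD le_max lexx ?orbT.
have t0 j x : transfer j (cst 0) x = mp_weight S j x by exact: addr0.
have [_ dE] := densityP (mpIFS_compact S) mup.1.
apply/eqP; rewrite eq_le; apply/andP; split.
  apply: lub => j; rewrite -[leRHS]mu0; apply: (maxplus_linear_le mup.1).
  by move=> x; rewrite t0; exact: q_le0.
rewrite -[leLHS]mu0 -lee_fin dE; apply/ereal_supP => _ [x _ <-].
rewrite adde0; apply/lee_addgt0Pr => e e0.
have : ((- e)%:E < ereal_sup (range (fun j => (mp_weight S j x)%:E)))%E.
  by rewrite mpIFS_normalized lte_fin oppr_lt0.
move=> /ereal_sup_gt[_ [j _ <-]]; rewrite lte_fin => qe.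
have : (density mu x + (mp_weight S j x)%:E <= (mpop mu (cst 0))%:E)%E.
  apply: (@le_trans _ _ (mu (transfer j (cst 0)))%:E); last by rewrite lee_fin.
  rewrite dE; apply: ereal_sup_ubound; exists x => //.
  by rewrite t0.
case: (density mu x) => [r| |].
- by rewrite -!EFinD !lee_fin; lra.
- by rewrite addye// leye_eq.
- by move=> _; rewrite leNye.
Qed.

End mpIFS_theory.

(* Main.v *)
Require Import Defs.
From HB Require Import structures.
From mathcomp Require Import all_boot all_order all_algebra.
From mathcomp Require Import all_classical all_reals all_analysis.
From mathcomp Require Import lra.

Import Order.TTheory GRing.Theory Num.Theory.
Import numFieldNormedType.Exports.

Local Open Scope classical_set_scope.
Local Open Scope ring_scope.

(** With constant weights everything is expressed by infinite codes. Give a code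
   [w = (j1, j2, ...)] the weight [q_j1 + q_j2 + ...], and let [f] be mapped to
   the supremum over all codes of weight plus [f] at the coded point. Removing
   the first letter of a code shows that this functional is invariant
   ([code_functional_invariant]); it is an idempotent probability because
   compactness of [J] provides a letter of weight [0], whose constant code has
   weight [0].

   Uniqueness ([invariant_unique]): iterating the operator [n] times writes an
   invariant [mu f] as a supremum over words [u] of length [n] of
   [mu (q_u + f \o phi_u)]. For large [n] the contraction makes [f \o phi_u]
   almost constant, uniformly in [u], and all idempotent probabilities almost
   agree on an almost constant function.

   The density is found by computing the Mane potential
   ([mane_eq_code_potential]). The prefixes of a code of [x] are words which
   send [z] close to [x], so the weight of the code is at most [S(x, z)].
   Conversely, near-optimal words for [S(x, z)] can be prolonged at almost no
   cost when [z] is in the Aubry set, because [z] has loops of weight close to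
   [0] ([aubry_loop]); a cluster point, in the compact space of codes, of such
   words of growing length is a code of [x] whose weight is as large as required
   ([code_of_long_words]). Hence [S(x, z)] is the best weight of a code of [x],
   and the invariant functional is the supremum of [S(x, z) + f x]. As
   [S(., z)] is visibly upper semicontinuous ([mane_usc]), uniqueness of
   densities identifies it with the density. *)

(** * Extended reals and series of nonpositive terms *)

Section nonpositive_series.
Context {R : realType}.
Implicit Types (u : nat -> R).

Lemma lee_fin_ltP (x y : \bar R) :
  (forall a : R, (a%:E < x)%E -> (a%:E <= y)%E) -> (x <= y)%E.
Proof.
case: x => [r| |] H; last exact: leNye.
  case: y H => [s| |] H; [|exact: leey|].
    rewrite lee_fin leNgt; apply/negP => sr.
    have := H ((s + r) / 2); rewrite lte_fin lee_fin; lra.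
  by have := H (r - 1); rewrite lte_fin ltrBlDr ltrDl ltr01 => /(_ isT).
case: y H => [s| |] H //; last by have := H 0 (ltry 0).
by have := H (s + 1) (ltry _); rewrite lee_fin gerDl ler10.
Qed.

(** The partial sums decrease, so the series is their infimum. *)
Lemma le_npeseriesP u (a : \bar R) : (forall k, u k <= 0) ->
  (a <= \sum_(0 <= k <oo) (u k)%:E)%E <->
  forall n, (a <= (\sum_(0 <= k < n) u k)%:E)%E.
Proof.
move=> u0; have u0' k : ((u k)%:E <= 0)%E by rewrite lee_fin.
have := @lee_sum_npos_natr _ (fun k => (u k)%:E) xpredT 0%N
  (fun n _ _ => u0' n).
move=> /ereal_nonincreasing_cvgn/(@cvg_lim _ (@ereal_hausdorff R)) ->//.
split=> [al n|an].
  by rewrite (le_trans al)// -sumEFin; apply: ereal_inf_lbound; exists n.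
by apply/ereal_infP => _ [n _ <-]; rewrite sumEFin; exact: an.
Qed.

Lemma npeseries_recl u : (forall k, u k <= 0) ->
  (\sum_(0 <= k <oo) (u k)%:E = (u 0%N)%:E + \sum_(0 <= k <oo) (u k.+1)%:E)%E.
Proof.
move=> u0; apply/cvg_lim => //.
rewrite -(cvg_shiftS (fun n => \sum_(0 <= k < n) (u k)%:E)%E).
under eq_cvg do rewrite /= big_nat_recl//.
apply: cvgeD; [exact: fin_num_adde_defr|exact: cvg_cst|].
by apply: is_cvg_npeseries => n _ _; rewrite lee_fin.
Qed.

End nonpositive_series.

(** * Max-plus functionals *)

Section functionals.
Context {R : realType} {X : metricType R}.
Implicit Types (f g : continuousType X R) (mu nu : continuousType X R -> R).

Section sup_functional.
Context {T : Type} (s : T -> \bar R) (p : T -> X).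

(** The functional [f |-> sup_t (s t + f (p t))]; the supremum is finite as soon
   as [f] is bounded, [s <= 0] and [s] vanishes somewhere. *)
Definition sup_functional f : R :=
  fine (ereal_sup (range (fun t => (s t + (f (p t))%:E)%E))).

Hypothesis X_compact : compact [set: X].
Hypothesis s_le0 : forall t, (s t <= 0)%E.
Hypothesis s_eq0 : exists t, s t = 0%E.

Lemma sup_functionalE f :
  (sup_functional f)%:E = ereal_sup (range (fun t => (s t + (f (p t))%:E)%E)).
Proof.
have [t0 st0] := s_eq0.
have [|c _ cP] := @compact_EVT_max X R f setT (ex_intro _ (p t0) I) X_compact.
  by apply: continuous_subspaceT; exact: cts_fun.
rewrite /sup_functional fineK//; apply/fin_numPlt/andP; split.
  rewrite (lt_le_trans (ltNyr (f (p t0))))//.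
  by apply: ereal_sup_ubound; exists t0 => //; rewrite st0 add0e.
rewrite (le_lt_trans _ (ltry (f c)))//; apply/ereal_supP => _ [t _ <-].
by rewrite -[leRHS]add0e leeD// lee_fin cP// inE.
Qed.

(** Max-plus identities for the functional are checked through its upper
   bounds. *)
Lemma sup_functional_leP f (c : R) :
  sup_functional f <= c <-> forall t, (s t + (f (p t))%:E <= c%:E)%E.
Proof.
rewrite -lee_fin sup_functionalE; split=> [fc t|fc].
  by apply: le_trans fc; apply: ereal_sup_ubound; exists t.
by apply/ereal_supP => _ [t _ <-].
Qed.

Lemma sup_functional_idempotent : idempotent_prob sup_functional.
Proof.
have [t0 st0] := s_eq0.
have eqP x y : (forall c : R, x <= c <-> y <= c) -> x = y.
  move=> xy; apply/eqP; rewrite eq_le.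
  by apply/andP; split; [apply/(xy y).2|apply/(xy x).1].
split; [split=> [a f|f g]|]; apply: eqP => c.
- rewrite addrC -lerBrDr !sup_functional_leP.
  split=> H t; move: (H t); rewrite max_scaleE; move: (s_le0 t);
    case: (s t) => [r| |] _; rewrite ?addNye ?leNye//;
    rewrite -!EFinD !lee_fin; lra.
- rewrite ge_max; split.
    rewrite sup_functional_leP => H; apply/andP.
    split; apply/sup_functional_leP => t; apply: le_trans (H t);
      by rewrite leeD2l// lee_fin max_addE le_max lexx ?orbT.
  move=> /andP[/sup_functional_leP fc /sup_functional_leP gc].
  apply/sup_functional_leP => t; rewrite max_addE.
  by case: (leP (f (p t)) (g (p t))) => _; [exact: gc|exact: fc].
- rewrite sup_functional_leP; split=> [/(_ t0)|c0 t].
    by rewrite st0 add0e lee_fin.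
  by rewrite adde0 (le_trans (s_le0 t))// lee_fin.
Qed.

End sup_functional.

(** Any two idempotent probabilities take values between the infimum and the
   supremum of [g]. *)
Lemma idempotent_prob_osc mu nu g (e : R) :
  idempotent_prob mu -> idempotent_prob nu ->
  (forall x y, g x <= g y + e) -> mu g <= nu g + e.
Proof.
have cstE (m : continuousType X R -> R) (c : R) :
    idempotent_prob m -> m (max_scale c (cst 0)) = c.
  by move=> [[mZ _] m0]; rewrite mZ m0 addr0.
move=> mup nup ge; rewrite -lerBlDr -[leLHS](cstE nu)//.
apply: (maxplus_linear_le nup.1) => y.
rewrite max_scaleE addr0 lerBlDr -[leRHS](cstE mu)//.
by apply: (maxplus_linear_le mup.1) => x; rewrite max_scaleE addr0.
Qed.

Lemma compact_unif_continuous f (e : R) : compact [set: X] -> 0 < e ->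
  exists2 d : R, 0 < d & forall x y, mdist x y < d -> `|f x - f y| < e.
Proof.
move=> /compact_near_coveringP cX e0.
pose P (d : R) (x : X) := forall y, mdist x y < d -> `|f x - f y| < e.
have near_P : \forall d \near 0^'+, [set: X] `<=` P d.
  apply: cX => x _.
  have e2 : 0 < e / 2 by rewrite divr_gt0.
  have /cvgrPdist_lt/(_ _ e2)/nbhs_ballP[r /= r0 rP] : f y @[y --> x] --> f x.
    exact: cts_fun.
  have r2 : 0 < r / 2 by rewrite divr_gt0.
  exists (ball x (r / 2), [set d | d < r / 2]) => /=.
    by split; [exact: nbhsx_ballx|exact: nbhs_right_lt].
  move=> [y d] [/= xy dr] z yz.
  have xy2 : ball x r y by apply: le_ball xy; lra.
  have xz2 : ball x r z.
    rewrite ballEmdist/= (le_lt_trans (metric_triangle x y z))//.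
    by move: xy; rewrite ballEmdist/= => xy; lra.
  have := rP _ xy2; have := rP _ xz2.
  by rewrite /= !ltr_norml => /andP[? ?] /andP[? ?]; apply/andP; split; lra.
have [d [d0 dP]] := filter_ex (filterI (nbhs_right_gt 0) near_P).
by exists d => // x; exact: dP.
Qed.

End functionals.

(** * Words, codings and the Mane potential *)

Section words.
Context {R : realType} {X J : metricType R} (S : mpIFS X J).
Implicit Types (x y z : X) (j : J) (f : continuousType X R) (u v : seq J).
Implicit Types (w : nat -> J) (mu nu : continuousType X R -> R).

Lemma word_map_cat u v x :
  word_map S (u ++ v) x = word_map S u (word_map S v x).
Proof. exact: foldr_cat. Qed.

Lemma word_sum_cat u v x :
  word_sum S (u ++ v) x = word_sum S u (word_map S v x) + word_sum S v x.
Proof.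
elim: u => [|j u IH] /=; first by rewrite add0r.
by rewrite IH word_map_cat addrA.
Qed.

Lemma word_sum_le0 u x : word_sum S u x <= 0.
Proof. by elim: u => //= j u IH; rewrite -[leRHS]addr0 lerD// q_le0. Qed.

Lemma word_map_nonexpansive u x y :
  mdist (word_map S u x) (word_map S u y) <= mdist x y.
Proof.
have [g /andP[g0 g1] gP] := word_map_contract S.
by rewrite (le_trans (gP _ _ _))// ler_piMl ?mdist_ge0// exprn_ile1// ltW.
Qed.

(** The contraction makes the images of [X] under long words uniformly small,
   because [X] has finite diameter. *)
Lemma word_map_shrink (e : R) : 0 < e -> exists N : nat,
  forall u, (N <= size u)%N -> forall x y,
    mdist (word_map S u x) (word_map S u y) < e.
Proof.
move=> e0; have [D D0 DP] := diameter_bounded S.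
have [g /andP[g0 g1] gP] := word_map_contract S.
have gD : g ^+ n * D @[n --> \oo] --> 0.
  rewrite -(mul0r D); apply: cvgMr_tmp; apply: cvg_expr.
  by rewrite gtr0_norm.
have [N _ NP] := cvgr_lt _ gD _ e0; exists N => u Nu x y.
rewrite (le_lt_trans (gP _ _ _))// (le_lt_trans _ (NP _ Nu))//=.
by rewrite ler_wpM2l// exprn_ge0// ltW.
Qed.

(** Long words forget their argument, so one base point [z] suffices to test
   whether [w] codes [x]. *)
Lemma is_coding_near z w x :
  (forall e : R, 0 < e ->
    \forall n \near \oo, mdist x (word_map S (mkseq w n) z) < e) ->
  is_coding S w x.
Proof.
move=> wx xs; apply/metricType_numDomainType.cvgrPdist_lt => e e0.
have e2 : 0 < e / 2 by rewrite divr_gt0.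
have [N NP] := word_map_shrink _ e2; near=> n.
rewrite (splitr e).
rewrite (le_lt_trans (metric_triangle _ (word_map S (mkseq w n) z) _))//.
rewrite ltrD//; first by near: n; exact: wx.
by apply: NP; rewrite size_mkseq; near: n; exact: nbhs_infty_ge.
Unshelve. all: by end_near. Qed.

Lemma coding_eq w x : is_coding S w x -> coding S w = x.
Proof. exact/is_coding_unique/codingP. Qed.

(** The first letter is the last map applied, and that map is continuous. *)
Lemma coding_recl w :
  coding S w = mp_map S (w 0%N) (coding S (fun n => w n.+1)).
Proof.
have [z _] := mpIFS_nonempty S.
have mkseqS n : mkseq w n.+1 = w 0%N :: mkseq (fun k => w k.+1) n.
  by rewrite /mkseq /= -[1%N]addn0 iotaDl -map_comp.
have tail_cvg : mp_map S (w 0%N) (word_map S (mkseq (fun k => w k.+1) n) z)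
    @[n --> \oo] --> mp_map S (w 0%N) (coding S (fun k => w k.+1)).
  apply: continuous_cvg; first exact: mp_map_continuous.
  exact: (@codingP _ _ _ S (fun k => w k.+1) (fun=> z)).
apply/coding_eq/(is_coding_near z) => e e0.
have [N _ NP] := metricType_numDomainType.cvgr_dist_lt tail_cvg e0.
by exists N.+1 => // -[//|n] Nn; rewrite mkseqS; exact: NP.
Qed.

(** Enlarging [e] admits more words, so the limit at [0] is an infimum. *)
Lemma mane_epsE x y :
  mane S x y = ereal_inf ((fun e => mane_eps S e x y) @` [set e | 0 < e]).
Proof.
have -> : [set e : R | 0 < e] = [set` Interval (BRight 0) +oo%O].
  by apply/seteqP; split=> e /=; rewrite in_itv/= andbT.
apply/cvg_lim => //; apply: nondecreasing_at_right_cvge => //.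
move=> e d _ _ ed; apply: le_ereal_sup => _ [u [u0 ux] <-]; exists u => //.
by split=> //; exact: lt_le_trans ed.
Qed.

Lemma mane_le (e : R) x y : 0 < e -> (mane S x y <= mane_eps S e x y)%E.
Proof. by move=> e0; rewrite mane_epsE; apply: ereal_inf_lbound; exists e. Qed.

Lemma mane_ge x y (a : \bar R) :
  (forall e : R, 0 < e -> (a <= mane_eps S e x y)%E) -> (a <= mane S x y)%E.
Proof.
move=> ae; rewrite mane_epsE; apply/ereal_infP => _ [e e0 <-]; exact: ae.
Qed.

Lemma mane_gt_word x y (a e : R) : (a%:E < mane S x y)%E -> 0 < e ->
  exists u, [/\ (0 < size u)%N, mdist x (word_map S u y) < e &
    a < word_sum S u y].
Proof.
move=> axy e0; have /ereal_sup_gt[_ [u [u0 ux] <-]] :=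
  lt_le_trans axy (mane_le _ x y e0).
by rewrite lte_fin => au; exists u.
Qed.

(** A strict bound at [x] holds for some [mane_eps e x], and this bounds
   [mane_eps (e / 2)] at all points of the ball of radius [e / 2]. *)
Lemma mane_usc y : upper_semicontinuous (fun x => mane S x y).
Proof.
move=> x a; rewrite {1}mane_epsE => /ereal_inf_lt[_ [e /= e0 <-]] ea.
have e2 : 0 < e / 2 by rewrite divr_gt0.
exists (ball x (e / 2)); first exact: nbhsx_ballx.
move=> t; rewrite ballEmdist/= => xt; apply: le_lt_trans ea.
apply: le_trans (mane_le _ _ _ e2) _.
apply: le_ereal_sup => _ [u [u0 ut] <-]; exists u => //; split=> //.
by rewrite (le_lt_trans (metric_triangle _ t _))// [ltRHS]splitr ltrD.
Qed.

(** The letters are transferred from the left, that is, starting with the one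
   whose map acts last; this order makes [f] become
   [word_sum u + f \o word_map u]. *)
Definition word_transfer u f : continuousType X R :=
  foldl (fun g j => transfer S j g) f u.

Lemma word_transferE u f x :
  word_transfer u f x = word_sum S u x + f (word_map S u x).
Proof.
rewrite /word_transfer; elim: u f => [|j u IH] f /=; first by rewrite add0r.
by rewrite IH transferE addrA [word_sum S u x + _]addrC.
Qed.

Lemma invariant_transfer_le mu f j : idempotent_prob mu -> mp_invariant S mu ->
  mu (transfer S j f) <= mu f.
Proof.
move=> mup muinv; rewrite -[in leRHS]muinv.
by apply: (ub_le_sup (has_sup_mpop S f mup).2); exists j.
Qed.

(** With [invariant_le], this writes an invariant functional, for every length
   [n], as the supremum of its values on the [n]-fold transfers of [f]. *)
Lemma invariant_word_transfer_le mu f u :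
  idempotent_prob mu -> mp_invariant S mu -> mu (word_transfer u f) <= mu f.
Proof.
move=> mup muinv; rewrite /word_transfer; elim: u f => [|j u IH] f //=.
by rewrite (le_trans (IH _))// invariant_transfer_le.
Qed.

Lemma invariant_le mu f n (c : R) : idempotent_prob mu -> mp_invariant S mu ->
  (forall u, size u = n -> mu (word_transfer u f) <= c) -> mu f <= c.
Proof.
move=> mup muinv; elim: n f => [|n IH] f H; first exact: (H [::]).
rewrite -muinv; apply: ge_sup; first exact: (has_sup_mpop S f mup).1.
by move=> _ [j _ <-]; apply: IH => u un; apply: (H (j :: u)); rewrite /= un.
Qed.

End words.

(** * Continuity along codes *)

Section code_space.
Context {R : realType} {X J : metricType R} (S : mpIFS X J).

Lemma mp_map_joint_continuous : continuous (fun p : J * X => mp_map S p.1 p.2).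
Proof.
have [g /andP[g0 g1] gP] := mpIFS_contract S.
move=> p; apply/metricType_numDomainType.cvgrPdist_lt => e e0.
have e2 : 0 < e / 2 by rewrite divr_gt0.
near=> t.
have t1 : mdist p.1 t.1 < e / 2.
  suff : ball p.1 (e / 2) t.1 by rewrite ballEmdist.
  by near: t; apply: cvg_fst; exact: nbhsx_ballx.
have t2 : mdist p.2 t.2 < e / 2.
  suff : ball p.2 (e / 2) t.2 by rewrite ballEmdist.
  by near: t; apply: cvg_snd; exact: nbhsx_ballx.
rewrite (le_lt_trans (gP _ _ _ _))//.
rewrite (@le_lt_trans _ _ (mdist p.1 t.1 + mdist p.2 t.2))//.
  by rewrite ler_piMl ?addr_ge0 ?mdist_ge0// ltW.
by rewrite [ltRHS]splitr ltrD.
Unshelve. all: by end_near. Qed.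

Context {T : topologicalType} (c : T -> nat -> J).
Hypothesis c_continuous : forall i, continuous (fun t => c t i).

(** A finite word read off a code depends on finitely many coordinates only; the
   space [T] of codes enters through the continuity of these coordinates. *)
Lemma word_map_code_continuous (s : seq nat) z :
  continuous (fun t => word_map S (map (c t) s) z).
Proof.
elim: s => [|i s IH] t /=; first exact: cvg_cst.
apply: (continuous_comp (f := fun t => (c t i, word_map S (map (c t) s) z))
  (g := fun p : J * X => mp_map S p.1 p.2)).
  by apply: cvg_pair; [exact: c_continuous|exact: IH].
exact: mp_map_joint_continuous.
Qed.

Lemma word_sum_code_continuous (s : seq nat) z :
  continuous (fun t => word_sum S (map (c t) s) z).
Proof.
elim: s => [|i s IH] t /=; first exact: cvg_cst.
apply: cvgD; last exact: IH.
apply: (continuous_comp (f := fun t => (c t i, word_map S (map (c t) s) z))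
  (g := fun p : J * X => mp_weight S p.1 p.2)).
  apply: cvg_pair; [exact: c_continuous|].
  exact: word_map_code_continuous.
exact: mpIFS_continuous.
Qed.

End code_space.

(** * Constant weights: the invariant functional and its density *)

Section constant_weights.
Context {R : realType} {X J : metricType R} (S : mpIFS X J) (q : J -> R).
Hypothesis weightE : forall j x, mp_weight S j x = q j.

Lemma weight_le0 j : q j <= 0.
Proof. by have [x _] := mpIFS_nonempty S; rewrite -(weightE j x) q_le0. Qed.

(** The normalization [sup_j q_j = 0] is attained, by compactness of [J]. *)
Lemma weight_eq0 : exists j, q j = 0.
Proof.
have [x _] := mpIFS_nonempty S.
have qE : q = fun j => mp_weight S j x by apply/funext => j; rewrite weightE.
have [|j _ jP] := @compact_EVT_max J R q setT
  (index_nonempty S) (mpIFS_compact_index S).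
  apply: continuous_subspaceT => j; rewrite qE.
  apply: (continuous_comp (f := fun j => (j, x))
    (g := fun p : J * X => mp_weight S p.1 p.2)).
    by apply: cvg_pair; [exact: cvg_id|exact: cvg_cst].
  exact: mpIFS_continuous.
exists j; apply/eqP; rewrite eq_le weight_le0 /=.
suff : (ereal_sup (range (fun k => (mp_weight S k x)%:E)) <= (q j)%:E)%E.
  by rewrite mpIFS_normalized lee_fin.
apply/ereal_supP => _ [k _ <-].
by rewrite weightE lee_fin jP// inE.
Qed.

Lemma word_sumE (u : seq J) x : word_sum S u x = \sum_(j <- u) q j.
Proof.
by elim: u => [|j u IH] /=; rewrite ?big_nil// big_cons weightE IH.
Qed.

Lemma word_sum_mkseq (w : nat -> J) n x :
  word_sum S (mkseq w n) x = \sum_(0 <= k < n) q (w k).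
Proof. by rewrite word_sumE big_map /index_iota subn0. Qed.

(** Long words send all of [X] into sets so small that [f] is almost constant on
   them, so an invariant functional is determined by the weights and the maps. *)
Lemma invariant_unique mu nu : idempotent_prob mu -> mp_invariant S mu ->
  idempotent_prob nu -> mp_invariant S nu -> mu = nu.
Proof.
suff H mu1 mu2 f : idempotent_prob mu1 -> mp_invariant S mu1 ->
    idempotent_prob mu2 -> mp_invariant S mu2 -> mu1 f <= mu2 f.
  by move=> *; apply/funext => f; apply/eqP; rewrite eq_le !H.
move=> p1 i1 p2 i2; apply/ler_addgt0Pr => e e0.
have [d d0 dP] := compact_unif_continuous f e (mpIFS_compact S) e0.
have [n nP] := word_map_shrink S _ d0.
apply: (invariant_le S _ _ n) => // u un.
rewrite (@le_trans _ _ (mu2 (word_transfer S u f) + e))//; last first.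
  by rewrite lerD2r invariant_word_transfer_le.
apply: idempotent_prob_osc => // x y.
rewrite !word_transferE !word_sumE -addrA lerD2l -lerBlDl.
by rewrite (le_trans (ler_norm _))// ltW// dP// nP// un.
Qed.

Definition code_sum (w : nat -> J) : \bar R :=
  (\sum_(0 <= k <oo) (q (w k))%:E)%E.

Definition code_potential (x : X) : \bar R :=
  ereal_sup [set code_sum w | w in coding S @^-1` [set x]].

Lemma code_sum_le0 w : (code_sum w <= 0)%E.
Proof. by apply: npeseries_le0 => n _ _; rewrite lee_fin weight_le0. Qed.

Lemma code_sum_eq0 : exists w, code_sum w = 0%E.
Proof.
have [j qj] := weight_eq0; exists (fun=> j).
by apply: eseries0 => n _ _; rewrite qj.
Qed.

Definition code_functional := sup_functional code_sum (coding S).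

Lemma code_functional_idempotent : idempotent_prob code_functional.
Proof.
apply: sup_functional_idempotent; first exact: (mpIFS_compact S).
- exact: code_sum_le0.
- exact: code_sum_eq0.
Qed.

Lemma code_functional_leP f (c : R) :
  code_functional f <= c <->
  forall w, (code_sum w + (f (coding S w))%:E <= c%:E)%E.
Proof.
apply: sup_functional_leP; first exact: (mpIFS_compact S).
- exact: code_sum_le0.
- exact: code_sum_eq0.
Qed.

(** Splitting off the first letter of a code turns one supremum into the
   other. *)
Lemma code_functional_invariant : mp_invariant S code_functional.
Proof.
have idem := code_functional_idempotent.
have termE w (f : continuousType X R) : (code_sum w + (f (coding S w))%:E =
    code_sum (fun n => w n.+1) +
    (transfer S (w 0%N) f (coding S (fun n => w n.+1)))%:E)%E.
  rewrite /code_sum npeseries_recl; last by move=> k; exact: weight_le0.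
  by rewrite transferE weightE -coding_recl EFinD addeCA addeA.
apply/funext => f; apply/eqP; rewrite eq_le; apply/andP; split.
  apply: ge_sup; first exact: (has_sup_mpop S f idem).1.
  move=> _ [j _ <-]; apply/code_functional_leP => w.
  pose jw n := if n is k.+1 then w k else j.
  have := (code_functional_leP f _).1 (lexx _) jw.
  by rewrite termE.
apply/code_functional_leP => w; rewrite termE.
apply: le_trans (_ : (code_functional (transfer S (w 0%N) f))%:E <= _)%E.
  exact: (code_functional_leP _ _).1 (lexx _) _.
rewrite lee_fin; apply: (ub_le_sup (has_sup_mpop S f idem).2).
by exists (w 0%N).
Qed.

(** The prefixes of a code of [x] compete in [S(x, z)] for every base point [z],
   and their sums dominate the infinite sum. *)
Lemma code_potential_le_mane z x : (code_potential x <= mane S x z)%E.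
Proof.
apply/ereal_supP => _ [w /= wx <-]; apply: mane_ge => e e0.
have wx' : is_coding S w x by rewrite -wx; exact: codingP.
have [n [n0 nx]] := filter_ex (filterI (nbhs_infty_gt 0)
  (metricType_numDomainType.cvgr_dist_lt (wx' (fun=> z)) e0)).
apply: (@le_trans _ _ (word_sum S (mkseq w n) z)%:E).
  rewrite word_sum_mkseq; move: n {n0 nx}; apply/le_npeseriesP => // k.
  exact: weight_le0.
by apply: ereal_sup_ubound; exists (mkseq w n) => //; rewrite /= size_mkseq.
Qed.

(** Concatenating loops at [z], with the allowed errors halved at each step, gives
   a long loop: the maps do not increase distances, and the sums add up because
   the weights are constant. *)
Lemma aubry_loop z n (e d : R) : aubry S z -> 0 < e -> 0 < d ->
  exists u, [/\ (n <= size u)%N, mdist z (word_map S u z) < e &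
    - d < word_sum S u z].
Proof.
move=> za; elim: n e d => [|n IH] e d e0 d0.
  by exists [::]; rewrite /= mdistxx oppr_lt0.
have e2 : 0 < e / 2 by rewrite divr_gt0.
have d2 : 0 < d / 2 by rewrite divr_gt0.
have [u [un uz us]] := IH _ _ e2 d2.
have z_gt : ((- (d / 2))%:E < mane S z z)%E.
  by move: za; rewrite /aubry /= => ->; rewrite lte_fin oppr_lt0.
have [v [v0 vz vs]] := mane_gt_word S _ _ _ _ z_gt e2.
exists (u ++ v); split.
- by rewrite size_cat -addn1 leq_add.
- rewrite word_map_cat (le_lt_trans (metric_triangle _ (word_map S u z) _))//.
  rewrite [ltRHS]splitr ltr_leD// (le_trans (word_map_nonexpansive _ _ _ _))//.
  exact: ltW.
- move: us; rewrite word_sum_cat !word_sumE => us.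
  by move: vs; rewrite word_sumE => vs; lra.
Qed.

(** A long loop at [z] applied first prolongs any word without changing much its
   sum or its end point. *)
Lemma mane_gt_long_word z x (a e : R) n : aubry S z ->
  (a%:E < mane S x z)%E -> 0 < e ->
  exists u, [/\ (n <= size u)%N, mdist x (word_map S u z) < e &
    a < word_sum S u z].
Proof.
move=> za ax e0; have e2 : 0 < e / 2 by rewrite divr_gt0.
have [u [_ ux us]] := mane_gt_word S _ _ _ _ ax e2.
have d0 : 0 < word_sum S u z - a by rewrite subr_gt0.
have [v [vn vz vs]] := aubry_loop _ n _ _ za e2 d0.
exists (u ++ v); split.
- by rewrite size_cat (leq_trans vn)// leq_addl.
- rewrite word_map_cat (le_lt_trans (metric_triangle _ (word_map S u z) _))//.
  rewrite [ltRHS]splitr ltr_leD// (le_trans (word_map_nonexpansive _ _ _ _))//.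
  exact: ltW.
- rewrite word_sum_cat word_sumE -(word_sumE u z).
  by lra.
Qed.

Local Notation codes := (prod_topology (fun _ : nat => J)).

Lemma codes_compact : compact [set: codes].
Proof.
have := @tychonoff nat (fun=> J) (fun=> setT) (fun=> mpIFS_compact_index S).
by congr (compact _); apply/seteqP; split.
Qed.

(** Compactness step: extend words of growing length to codes and take a cluster
   point [w]. Prefixes of those words approximate every prefix of [w]; its sum
   stays at least [a] because prolonging a word can only decrease the sum, and
   the maps of its prefixes lead to [x]. *)
Lemma code_of_long_words z x (a : R) :
  (forall n (e : R), 0 < e -> exists u, [/\ (n <= size u)%N,
     mdist x (word_map S u z) < e & a < word_sum S u z]) ->
  exists2 w, coding S w = x & (a%:E <= code_sum w)%E.
Proof.
move=> H; have [j0 _] := index_nonempty S.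
have /choice[v vP] (n : nat) : exists u, [/\ (n <= size u)%N,
    mdist x (word_map S u z) < n.+1%:R^-1 & a < word_sum S u z].
  by apply: H; rewrite invr_gt0.
(* The default letter [j0] extends the word [v n] to a code. *)
pose c n : codes := nth j0 (v n).
have cE n m : (m <= n)%N -> v n = mkseq (c n) m ++ drop m (v n).
  have [vn _ _] := vP n => mn.
  rewrite -[LHS](cat_take_drop m); congr (_ ++ _).
  by rewrite -[in LHS](mkseq_nth j0 (v n)) /mkseq -map_take take_iota
    (minn_idPl (leq_trans mn vn)).
have [w [_ wP]] := codes_compact (c @ \oo) _ filterT.
have w_closed (h : codes -> R) (D : set R) : continuous h -> closed D ->
    (\forall n \near \oo, D (h (c n))) -> D (h w).
  move=> h_cont D_closed Dc.
  have hD_closed : closed (h @^-1` D).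
    by apply: preimage_closed => // t _; exact: h_cont.
  by apply: hD_closed => B wB; exact: wP.
exists w; last first.
  apply/le_npeseriesP => [k|m]; first exact: weight_le0.
  rewrite lee_fin -(word_sum_mkseq w m z).
  apply: (w_closed (fun w => word_sum S (mkseq w m) z) [set r | a <= r]).
  - exact: (@word_sum_code_continuous _ _ _ S codes id (@proj_continuous _ _)).
  - exact: closed_ge.
  near=> n; have [_ _] := vP n; rewrite {1}(cE n m); last first.
    by near: n; exact: nbhs_infty_ge.
  rewrite word_sum_cat !word_sumE => /ltW/le_trans; apply.
  by rewrite gerDl -(word_sumE _ z) word_sum_le0.
apply/coding_eq/(is_coding_near _ z) => e e0.
(* The cluster point inherits weak inequalities only, hence [e / 2]; this is
   shared between the end points of [v n] and the cut at the letter [m]. *)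
have e4 : 0 < e / 2 / 2 by rewrite !divr_gt0.
have [N NP] := word_map_shrink S _ e4.
near=> m; apply: (@le_lt_trans _ _ (e / 2)); last by lra.
apply: (w_closed (fun w => mdist x (word_map S (mkseq w m) z))
  [set r | r <= e / 2]).
- move=> t; apply: (@continuous_comp codes X R
    (fun w => word_map S (mkseq w m) z) (mdist x));
    last exact: mdist_continuous.
  exact: (@word_map_code_continuous _ _ _ S codes id (@proj_continuous _ _)).
- exact: closed_le.
near=> n; have [_ vx _] := vP n.
rewrite /= (le_trans (metric_triangle _ (word_map S (v n) z) _))//.
rewrite [leRHS]splitr lerD//; apply: ltW.
  apply: lt_trans vx _; near: n; exact: near_infty_natSinv_lt (PosNum e4).
rewrite (cE n m) ?word_map_cat; last by near: n; exact: nbhs_infty_ge.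
apply: NP; rewrite size_mkseq; near: m; exact: nbhs_infty_ge.
Unshelve. all: by end_near. Qed.

Lemma mane_eq_code_potential z x : aubry S z -> mane S x z = code_potential x.
Proof.
move=> za; apply/eqP; rewrite eq_le code_potential_le_mane andbT.
apply: lee_fin_ltP => a am.
have [w wx aw] := code_of_long_words z x a
  (fun n e e0 => mane_gt_long_word _ _ _ _ n za am e0).
by apply: le_trans aw _; apply: ereal_sup_ubound; exists w.
Qed.

(** Grouping the codes by the point they code turns the supremum over codes into
   one over [X] of [code_potential x + f x]. *)
Lemma code_functional_density z : aubry S z ->
  is_density code_functional (fun x => mane S x z).
Proof.
move=> za; have pot_le0 x : (code_potential x <= 0)%E.
  by apply/ereal_supP => _ [w _ <-]; exact: code_sum_le0.
have [w0 w00] := code_sum_eq0.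
have pot_ge0 : (0 <= code_potential (coding S w0))%E.
  by rewrite -w00; apply: ereal_sup_ubound; exists w0.
split; first split.
- move=> x; rewrite mane_eq_code_potential// lt_eqF//.
  by rewrite (le_lt_trans (pot_le0 x)).
- exact: mane_usc.
- exists (coding S w0); rewrite gt_eqF//.
  rewrite (lt_le_trans (ltNyr 0))// (le_trans pot_ge0)//.
  exact: code_potential_le_mane.
move=> f; rewrite sup_functionalE; first last.
- exact: code_sum_eq0.
- exact: code_sum_le0.
- exact: (mpIFS_compact S).
apply/eqP; rewrite eq_le; apply/andP; split; apply/ereal_supP.
  move=> _ [w _ <-].
  apply: (@le_trans _ _ (mane S (coding S w) z + (f (coding S w))%:E)%E).
    rewrite leeD2r// (le_trans _ (code_potential_le_mane _ _))//.
    by apply: ereal_sup_ubound; exists w.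
  by apply: ereal_sup_ubound; exists (coding S w).
move=> _ [x _ <-]; rewrite -leeBrDr// mane_eq_code_potential//.
apply/ereal_supP => _ [w wx <-].
have <- : coding S w = x by [].
rewrite leeBrDr//.
by apply: ereal_sup_ubound; exists w.
Qed.

End constant_weights.

Theorem theorem4p7 (R : realType) (X J : metricType R) (S : mpIFS X J)
    (qc : J -> R) (hq : forall (j : J) (x : X), mp_weight S j x = qc j) :
  (exists! mu : continuousType X R -> R,
      idempotent_prob mu /\ mp_invariant S mu) /\
  (forall mu : continuousType X R -> R,
      idempotent_prob mu -> mp_invariant S mu ->
    forall z : X, aubry S z -> forall x : X,
      density mu x = mane S x z /\
      mane S x z =
        ereal_sup [set (\sum_(0 <= k <oo) (qc (w k))%:E)%E | w in
          coding S @^-1` [set x]]).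
Proof.
have idem := code_functional_idempotent S qc hq.
have inv := code_functional_invariant S qc hq.
split.
  exists (code_functional S qc); split=> // nu [nup nuinv].
  exact: (invariant_unique S qc).
move=> mu mup muinv z za x; split; last exact: mane_eq_code_potential.
rewrite (invariant_unique S qc hq mu _ mup muinv idem inv).
rewrite (is_density_unique (densityP (mpIFS_compact S) idem.1)
  (code_functional_density S qc hq z za))//.
Qed.
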